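(* For $r>0$, let $\mathcal{B}_r=\{\varphi_{(r,h)}:h\in\mathbb{S}^3\}\simeq\mathbb{RP}^3$ be the isometric class of $\mathrm{Sp}(2)$-invariant $\mathrm{G}_2$-structures on $\mathbb{S}^7=\mathrm{Sp}(2)/\mathrm{Sp}(1)$ inducing the metric $g_r$. The set $\mathrm{Crit}(E|_{\mathcal{B}_r})$ of harmonic $\mathrm{G}_2$-structures in $\mathcal{B}_r$ is described as follows. If $r\neq1$: the harmonic $\mathrm{G}_2$-structures in $\mathcal{B}_r$ are precisely those parametrised by the equator $\{r\}\times\mathbb{RP}^2$, with $\mathbb{RP}^2=\{[(h_0,h_1,0,h_3)]\}$, or the poles $\{r\}\times\mathrm{NS}$, with $\mathrm{NS}=[(0,0,\pm1,0)]$. If $r=1$: all the $\mathrm{G}_2$-structures $\varphi_{(1,h)}$, with $h\in\mathbb{S}^3$, are harmonic.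
   Context: $\mathrm{Sp}(1)\subset\mathrm{Sp}(2)$ via $h\mapsto\mathrm{diag}(h,1)$; $\mathbb{S}^7=\mathrm{Sp}(2)/\mathrm{Sp}(1)$; $\mathfrak{p}=\mathfrak{sp}(1)^\perp\simeq T_o\mathbb{S}^7$ has basis $e_1=\mathrm{diag}(0,i)$, $e_2=\mathrm{diag}(0,j)$, $e_3=\mathrm{diag}(0,k)$, $e_4=\frac1{\sqrt2}\begin{pmatrix}0&i\\ i&0\end{pmatrix}$, $e_5=\frac1{\sqrt2}\begin{pmatrix}0&j\\ j&0\end{pmatrix}$, $e_6=\frac1{\sqrt2}\begin{pmatrix}0&k\\ k&0\end{pmatrix}$, $e_7=\frac1{\sqrt2}\begin{pmatrix}0&1\\-1&0\end{pmatrix}$, dual basis $e^i$; $\omega_1=e^{47}+e^{56}$, $\omega_2=e^{46}-e^{57}$, $\omega_3=e^{45}+e^{67}$. Invariant tensors on $\mathbb{S}^7$ are identified with $\mathrm{Ad}(\mathrm{Sp}(1))$-invariant tensors on $\mathfrak{p}$, and for invariant $1$-forms $d\alpha(X,Y)=-\alpha([X,Y]_{\mathfrak p})$. For $h=(h_0,h_1,h_2,h_3)\in\mathbb{S}^3$, $\varphi_{(r,h)}=r^3e^{123}+\sum_{i,l=1}^3\Upsilon(h)_{il}\,e^l\wedge\omega_i$, with $$\Upsilon(h)=\begin{pmatrix}h_0^2+h_1^2-h_2^2-h_3^2&2(h_1h_2-h_0h_3)&2(h_1h_3+h_0h_2)\\2(h_1h_2+h_0h_3)&h_0^2-h_1^2+h_2^2-h_3^2&2(h_2h_3-h_0h_1)\\2(h_1h_3-h_0h_2)&2(h_2h_3+h_0h_1)&h_0^2-h_1^2-h_2^2+h_3^2\end{pmatrix};$$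 it depends only on $[h]=\{\pm h\}$ and is identified with $(r,[h])$. It induces $g_r=r^2\sum_{i\le3}(e^i)^2+\frac1r\sum_{i\ge4}(e^i)^2$. The full torsion tensor $T$ of a $\mathrm{G}_2$-structure $\varphi$ with $\psi=*\varphi$ is the $2$-tensor with $\nabla_i\varphi_{jkl}=T_i{}^m\psi_{mjkl}$ ($\nabla$ the Levi-Civita connection of the induced metric); $(\mathrm{div}\,T)_j=\nabla^iT_{ij}$. The Dirichlet energy is $E(\varphi)=\frac12\int|T_\varphi|^2\mathrm{vol}_\varphi$, and $\varphi$ is harmonic if $\mathrm{div}\,T=0$, equivalently if $\varphi$ is critical for $E$ among $\mathrm{G}_2$-structures inducing the same metric and orientation. *)

(* Defs.v *)
From HB Require Import structures.
From mathcomp Require Import all_boot all_order all_algebra.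
From mathcomp Require Import ring.
From mathcomp Require Import all_classical all_reals all_analysis.
Set Implicit Arguments.
Unset Strict Implicit.
Unset Printing Implicit Defensive.
Import Order.TTheory GRing.Theory Num.Theory.
Import numFieldNormedType.Exports.
Local Open Scope classical_set_scope.
Local Open Scope ring_scope.

(** Sp(2)-invariant tensors on S^7 = Sp(2)/Sp(1) are identified with
    Ad(Sp(1))-invariant tensors on p = sp(1)^⊥, given by their components in
    the basis e_1, ..., e_7.  The ordinal [i : 'I_7] stands for the index i+1
    of that basis; [dx], [dx2] and [e123] take the usual indices 1, ..., 7. *)

Section Quaternions.
Variable R : realType.

Record quat := Quat { q0 : R; q1 : R; q2 : R; q3 : R }.

Definition quat_tuple (x : quat) := (q0 x, q1 x, q2 x, q3 x).
Definition tuple_quat (t : R * R * R * R) :=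
  let: (a, b, c, d) := t in Quat a b c d.
Fact quat_tupleK : cancel quat_tuple tuple_quat.
Proof. by case. Qed.
HB.instance Definition _ := Choice.copy quat (can_type quat_tupleK).

Definition qadd x y :=
  Quat (q0 x + q0 y) (q1 x + q1 y) (q2 x + q2 y) (q3 x + q3 y).
Definition qopp x := Quat (- q0 x) (- q1 x) (- q2 x) (- q3 x).
Definition qmul x y :=
  Quat (q0 x * q0 y - q1 x * q1 y - q2 x * q2 y - q3 x * q3 y)
       (q0 x * q1 y + q1 x * q0 y + q2 x * q3 y - q3 x * q2 y)
       (q0 x * q2 y - q1 x * q3 y + q2 x * q0 y + q3 x * q1 y)
       (q0 x * q3 y + q1 x * q2 y - q2 x * q1 y + q3 x * q0 y).
Definition qconj x := Quat (q0 x) (- q1 x) (- q2 x) (- q3 x).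

Fact qaddA : associative qadd.
Proof. by case=> ? ? ? ? [? ? ? ?] [? ? ? ?]; congr Quat; apply: addrA. Qed.
Fact qaddC : commutative qadd.
Proof. by case=> ? ? ? ? [? ? ? ?]; congr Quat; apply: addrC. Qed.
Fact qadd0 : left_id (Quat 0 0 0 0) qadd.
Proof. by case=> ? ? ? ?; congr Quat; apply: add0r. Qed.
Fact qaddN : left_inverse (Quat 0 0 0 0) qopp qadd.
Proof. by case=> ? ? ? ?; congr Quat; apply: addNr. Qed.
HB.instance Definition _ :=
  GRing.isZmodule.Build quat qaddA qaddC qadd0 qaddN.

Fact qmulA : associative qmul.
Proof. by case=> ? ? ? ? [? ? ? ?] [? ? ? ?]; congr Quat => /=; ring. Qed.
Fact qmul1 : left_id (Quat 1 0 0 0) qmul.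
Proof. by case=> ? ? ? ?; congr Quat => /=; ring. Qed.
Fact qmulr1 : right_id (Quat 1 0 0 0) qmul.
Proof. by case=> ? ? ? ?; congr Quat => /=; ring. Qed.
Fact qmulDl : left_distributive qmul +%R.
Proof. by case=> ? ? ? ? [? ? ? ?] [? ? ? ?]; congr Quat => /=; ring. Qed.
Fact qmulDr : right_distributive qmul +%R.
Proof. by case=> ? ? ? ? [? ? ? ?] [? ? ? ?]; congr Quat => /=; ring. Qed.
Fact qone_neq0 : Quat 1 0 0 0 != 0.
Proof. by apply/eqP => -[] /eqP; rewrite oner_eq0. Qed.
HB.instance Definition _ := GRing.Zmodule_isNzRing.Build quat
  qmulA qmul1 qmulr1 qmulDl qmulDr qone_neq0.

End Quaternions.

Section Sp2.
Variable R : realType.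

Definition mx22 (a b c d : quat R) : 'M[quat R]_2 :=
  \matrix_(i, j) nth 0 (nth [::] [:: [:: a; b]; [:: c; d]] i) j.

Definition adjoint (A : 'M[quat R]_2) : 'M[quat R]_2 := map_mx (@qconj R) A^T.

(** The Ad-invariant inner product <A, B> = Re tr(A^* B) on sp(2). *)
Definition inner (A B : 'M[quat R]_2) : R := q0 (\tr (adjoint A *m B)).

Definition lie (A B : 'M[quat R]_2) : 'M[quat R]_2 := A *m B - B *m A.

(** An orthonormal basis, for [inner], of the orthogonal complement p in sp(2)
    of sp(1) = {diag(a, 0) : Re a = 0}. *)
Definition basis_p (i : 'I_7) : 'M[quat R]_2 :=
  let s := (Num.sqrt 2)^-1 in
  nth 0 [:: mx22 0 0 0 (Quat 0 1 0 0);
            mx22 0 0 0 (Quat 0 0 1 0);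
            mx22 0 0 0 (Quat 0 0 0 1);
            mx22 0 (Quat 0 s 0 0) (Quat 0 s 0 0) 0;
            mx22 0 (Quat 0 0 s 0) (Quat 0 0 s 0) 0;
            mx22 0 (Quat 0 0 0 s) (Quat 0 0 0 s) 0;
            mx22 0 (Quat s 0 0 0) (Quat (- s) 0 0 0) 0] i.

(** [[e_i, e_j]_p = \sum_k bracket_p i j k e_k]. *)
Definition bracket_p (i j k : 'I_7) : R :=
  inner (basis_p k) (lie (basis_p i) (basis_p j)).

(** [Ad(diag(u, 1)) e_i = \sum_k Ad_p u i k e_k]. *)
Definition Ad_p (u : quat R) (i k : 'I_7) : R :=
  let D := mx22 u 0 0 1 in inner (basis_p k) (D *m basis_p i *m adjoint D).

End Sp2.

Section Tensors.
Variable R : realType.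

(** Covariant tensors on p.  The type does not impose alternation: a p-form is
    a tensor that is moreover alternating. *)
Definition tensor1 : Type := 'I_7 -> R.
Definition tensor2 : Type := 'I_7 -> 'I_7 -> R.
Definition tensor3 : Type := 'I_7 -> 'I_7 -> 'I_7 -> R.
Definition tensor4 : Type := 'I_7 -> 'I_7 -> 'I_7 -> 'I_7 -> R.

Definition Ad_invariant (phi : tensor3) : Prop :=
  forall u : quat R, u * qconj u = 1 -> forall i j k : 'I_7,
    \sum_a \sum_b \sum_c Ad_p u i a * Ad_p u j b * Ad_p u k c * phi a b c
      = phi i j k.

(** Levi-Civita symbol: the sign of the arrangement [s], and 0 in case of a
    repetition. *)
Fixpoint epsilon (s : seq 'I_7) : R :=
  if s is x :: s' then
    if x \in s' then 0
    else (-1) ^+ count (fun y : 'I_7 => (y < x)%N) s' * epsilon s'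
  else 1.

Definition dx (a : nat) : tensor1 := fun i => (i.+1 == a)%:R.

Definition wedge11 (alpha beta : tensor1) : tensor2 :=
  fun i j => alpha i * beta j - alpha j * beta i.

Definition wedge12 (alpha : tensor1) (omega : tensor2) : tensor3 :=
  fun i j k => alpha i * omega j k + alpha j * omega k i + alpha k * omega i j.

Definition dx2 (a b : nat) : tensor2 := wedge11 (dx a) (dx b).

Definition e123 : tensor3 := wedge12 (dx 1) (dx2 2 3).

(** The metric and the orientation induced by a 3-form φ are determined by
    (X ⌟ φ) ∧ (Y ⌟ φ) ∧ φ = 6 g(X, Y) vol_g.
    With vol_g = v e^{1...7} and [hitchin phi] the matrix of the coefficients of
    (1/6) (e_i ⌟ φ) ∧ (e_j ⌟ φ) ∧ φ on e^{1...7}, this reads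
    [hitchin phi = v *: g]; as v^2 = det g, one gets det (hitchin phi) = v^9. *)
Definition hitchin (phi : tensor3) : 'M[R]_7 :=
  \matrix_(i, j) (6^-1 * ((2`! * 2`! * 3`!)%N%:R^-1 *
    \sum_a \sum_b \sum_c \sum_d \sum_k \sum_l \sum_m
      epsilon [:: a; b; c; d; k; l; m] *
        phi i a b * phi j c d * phi k l m)).

(** The coefficient v (positive iff e^{1...7} is positively oriented). *)
Definition vol_coef (phi : tensor3) : R :=
  let d := \det (hitchin phi) in Num.sg d * `|d| `^ 9^-1.

Definition induced_metric (phi : tensor3) : 'M[R]_7 :=
  (vol_coef phi)^-1 *: hitchin phi.

Definition inv_metric (phi : tensor3) : 'M[R]_7 := invmx (induced_metric phi).

(** ψ = *φ for the induced metric and orientation. *)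
Definition hodge_psi (phi : tensor3) : tensor4 := fun a b c d =>
  let gi := inv_metric phi in
  (3`!)%:R^-1 * vol_coef phi *
  \sum_i \sum_j \sum_k \sum_i' \sum_j' \sum_k'
    gi i i' * gi j j' * gi k k' * phi i' j' k' *
    epsilon [:: i; j; k; a; b; c; d].

(** An invariant connection is a bilinear map Λ : p x p -> p, written
    Λ(e_i) e_j = \sum_k (Lam i j k) e_k, and it acts on invariant tensors by
    ∇_X t = Λ(X) . t (derivation).  In accordance with
    dα(X, Y) = - α([X, Y]_p), its torsion is
    Λ(X) Y - Λ(Y) X - [X, Y]_p. *)
Definition is_levi_civita (g : 'M[R]_7) (Lam : tensor3) : Prop :=
  (forall i j k, Lam i j k - Lam j i k = bracket_p R i j k) /\
  (forall i j k, \sum_m (Lam i j m * g m k + Lam i k m * g j m) = 0).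

(** The unique such connection. *)
Definition levi_civita (g : 'M[R]_7) : tensor3 :=
  xget (fun _ _ _ => 0) [set Lam : tensor3 | is_levi_civita g Lam].

Definition nabla2 (Lam : tensor3) (t : 'M[R]_7) : tensor3 := fun i j k =>
  - \sum_m (Lam i j m * t m k + Lam i k m * t j m).

Definition nabla3 (Lam : tensor3) (t : tensor3) : tensor4 := fun i j k l =>
  - \sum_m (Lam i j m * t m k l + Lam i k m * t j m l + Lam i l m * t j k m).

(** ∇_i φ_{jkl} = T_i^m ψ_{mjkl}. *)
Definition is_full_torsion (phi : tensor3) (T : 'M[R]_7) : Prop :=
  forall i j k l,
    nabla3 (levi_civita (induced_metric phi)) phi i j k l =
    \sum_m (T *m inv_metric phi) i m * hodge_psi phi m j k l.

(** The unique such tensor, when [phi] is a G2-structure. *)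
Definition full_torsion (phi : tensor3) : 'M[R]_7 :=
  xget 0 [set T | is_full_torsion phi T].

(** (div T)_j = ∇^i T_{ij}. *)
Definition div_torsion (phi : tensor3) : tensor1 := fun j =>
  \sum_i \sum_k inv_metric phi i k *
    nabla2 (levi_civita (induced_metric phi)) (full_torsion phi) k i j.

Definition is_harmonic (phi : tensor3) : Prop := forall j, div_torsion phi j = 0.

Definition sqnorm_torsion (phi : tensor3) : R :=
  let T := full_torsion phi in let gi := inv_metric phi in
  \sum_i \sum_j \sum_k \sum_l gi i k * gi j l * T i j * T k l.

(** The integral of e^{1...7} over S^7.  The round S^7 has volume π^4/3; under
    A |-> A (0, 1)^T the vectors e_1, e_2, e_3 become round-orthonormal while
    e_4, ..., e_7 become orthogonal of length 1/√2, so that e^{1...7} is 4 times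
    the round volume form. *)
Definition total_volume : R := 4 * pi ^+ 4 / 3.

(** The integrand being invariant, E(φ) = (1/2) |T|^2 Vol(S^7, g). *)
Definition energy (phi : tensor3) : R :=
  2^-1 * sqnorm_torsion phi * (`|vol_coef phi| * total_volume).

End Tensors.

Section Family.
Variable R : realType.

(** ω_1, ω_2, ω_3 are [omega 0], [omega 1], [omega 2]. *)
Definition omega (i : 'I_3) : tensor2 R := fun a b =>
  nth 0 [:: dx2 R 4 7 a b + dx2 R 5 6 a b;
            dx2 R 4 6 a b - dx2 R 5 7 a b;
            dx2 R 4 5 a b + dx2 R 6 7 a b] i.

Definition sphere3 : set 'rV[R]_4 := [set h | \sum_i h 0 i ^+ 2 = 1].

Definition Upsilon (h : 'rV[R]_4) : 'M[R]_3 :=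
  let h0 := h 0 0 in let h1 := h 0 1 in let h2 := h 0 2 in let h3 := h 0 3 in
  \matrix_(i, l) nth 0 (nth [::]
    [:: [:: h0 ^+ 2 + h1 ^+ 2 - h2 ^+ 2 - h3 ^+ 2;
            2 * (h1 * h2 - h0 * h3);
            2 * (h1 * h3 + h0 * h2)];
        [:: 2 * (h1 * h2 + h0 * h3);
            h0 ^+ 2 - h1 ^+ 2 + h2 ^+ 2 - h3 ^+ 2;
            2 * (h2 * h3 - h0 * h1)];
        [:: 2 * (h1 * h3 - h0 * h2);
            2 * (h2 * h3 + h0 * h1);
            h0 ^+ 2 - h1 ^+ 2 - h2 ^+ 2 + h3 ^+ 2]] i) l.

Definition phi_ (r : R) (h : 'rV[R]_4) : tensor3 R := fun a b c =>
  r ^+ 3 * e123 R a b c +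
  \sum_(i < 3) \sum_(l < 3)
    Upsilon h i l * wedge12 (dx R l.+1) (omega i) a b c.

Definition g_ (r : R) : 'M[R]_7 :=
  \matrix_(i, j) (if i == j then if (i < 3)%N then r ^+ 2 else r^-1 else 0).

Definition B_ (r : R) : set (tensor3 R) := phi_ r @` sphere3.

(** The points of [B_ r] at which E|_{B_r} is critical.  As h |-> φ_(r,h) is the
    double covering S^3 -> B_r = RP^3, criticality is tested upstairs, along the
    great circles through h. *)
Definition Crit (r : R) : set (tensor3 R) :=
  phi_ r @` [set h | sphere3 h /\
    forall v : 'rV[R]_4, sphere3 v -> \sum_i h 0 i * v 0 i = 0 ->
      is_derive (0 : R) 1
        (fun t : R => energy (phi_ r (cos t *: h + sin t *: v))) 0].

(** {r} x RP^2 with RP^2 = {[(h_0, h_1, 0, h_3)]}. *)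
Definition equator (r : R) : set (tensor3 R) :=
  phi_ r @` [set h | sphere3 h /\ h 0 2 = 0].

(** {r} x NS with NS = [(0, 0, ±1, 0)]. *)
Definition poles (r : R) : set (tensor3 R) :=
  phi_ r @` [set delta_mx 0 2; - delta_mx 0 2].

End Family.

(* Main.v *)
(* The trilinear form <[X, Y]_p, Z> on p is the 3-form
   br = 2 e^123 + e^1 w_1 - e^2 w_2 + e^3 w_3, so that the Levi-Civita connection
   of g_r is Lam_ijk = br_ijk (1 + (g_j - g_i) / g_k) / 2.  A skew endomorphism A
   acts on a G2-structure as the contraction of psi with the vector A_jk phi_mjk,
   up to a factor; applied to A = Lam_i this gives
   T_im = - (1/2) Lam_ij^k g^jj phi_mjk, which is linear in phi.  Hence div T is
   linear in Upsilon(h) and |T|^2 is quadratic; they come out as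
     div T = C (- h2 h3, - h2 h0, h2 h1, 0, 0, 0, 0),   |T|^2 = A + B h2^2,
   where C and B are positive multiples of (r^3 - 1) (r^3 + 2).  Both C and B
   vanish for r = 1, and otherwise harmonicity and criticality of the energy both
   say that h2 = 0 or h0 = h1 = h3 = 0.

   The tensor identities behind this are polynomial in r, 1/r, h0, ..., h3 modulo
   r (1/r) = 1 and |h|^2 = 1, and are decided by computing with polynomials with
   integer coefficients. *)
Require Import Defs.
From Stdlib Require Import ZArith Ring_polynom.
From mathcomp Require Import all_boot all_order all_algebra.
From mathcomp Require Import ssrZ zify ring lra.
From mathcomp Require Import all_classical all_reals all_analysis.
Import Order.TTheory GRing.Theory Num.Theory.
Import numFieldNormedType.Exports.
Set Implicit Arguments.
Unset Strict Implicit.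
Unset Printing Implicit Defensive.
Local Open Scope classical_set_scope.
Local Open Scope ring_scope.

(** * Computation with integer polynomials *)

Definition pol := Pol Z.
Definition pint (z : Z) : pol := Pc z.
Definition pnat (n : nat) : pol := pint (Z.of_nat n).
Definition padd : pol -> pol -> pol := Padd Z0 Z.add Z.eqb.
Definition popp : pol -> pol := Popp Z.opp.
Definition psub (p q : pol) : pol := padd p (popp q).
Definition is0 (p : pol) : bool := if p is Pc Z0 then true else false.
(* The second factor is a thunk, so that it is not evaluated when the first one
   vanishes; the sums below are mostly sparse. *)
Definition pmul (p : pol) (q : unit -> pol) : pol :=
  if is0 p then p else Pmul Z0 (Zpos xH) Z.add Z.mul Z.eqb p (q tt).
Definition psum (n : nat) (F : nat -> pol) : pol :=
  foldr (fun i p => padd (F i) p) (pnat 0) (iota 0 n).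
Definition var (i : nat) : pol := mk_X Z0 (Zpos xH) (Pos.of_nat i.+1).

Arguments pint : simpl never.
Arguments padd : simpl never.
Arguments popp : simpl never.
Arguments psub : simpl never.
Arguments pmul : simpl never.
Arguments psum : simpl never.
Arguments var : simpl never.

Declare Scope pol_scope.
Delimit Scope pol_scope with P.
Bind Scope pol_scope with pol.
Notation "p + q" := (padd p q) : pol_scope.
Notation "p - q" := (psub p q) : pol_scope.
Notation "p * q" := (pmul p (fun=> q)) : pol_scope.

(** * Evaluation of integer polynomials in a commutative ring *)

Section Evaluation.
Variables (R : comNzRingType) (env : seq R).

Definition ev (p : pol) : R :=
  Pphi 0 +%R *%R (fun z => (int_of_Z z)%:~R) env p.

Let eqR := Eqsth R.
Let extR := Eq_ext (@GRing.add R) *%R -%R.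
Let ringR := Rth_ARth eqR extR (common.RR R).
Let morphR := common.RZ R.

Lemma ev_int z : ev (pint z) = (int_of_Z z)%:~R. Proof. by []. Qed.

Lemma ev_nat n : ev (pnat n) = n%:R.
Proof. by rewrite ev_int pmulrn; congr (_ *~ _); lia. Qed.

Lemma evD p q : ev (p + q)%P = ev p + ev q.
Proof. exact: (Padd_ok eqR extR ringR morphR). Qed.

Lemma evN p : ev (popp p) = - ev p.
Proof. exact: (Popp_ok eqR extR ringR morphR). Qed.

Lemma evB p q : ev (p - q)%P = ev p - ev q.
Proof. by rewrite evD evN. Qed.

Lemma is0P p : is0 p -> ev p = 0.
Proof. by case: p => // -[]. Qed.

Lemma evM p q : ev (p * q)%P = ev p * ev q.
Proof.
rewrite /pmul; case: ifP => [/is0P->|_]; first by rewrite mul0r.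
exact: (Pmul_ok eqR extR ringR morphR).
Qed.

Lemma ev_sum n F : ev (psum n F) = \sum_(i < n) ev (F i).
Proof.
rewrite -(big_mkord xpredT (fun i => ev (F i))) unlock /index_iota subn0 /psum.
by elim: iota => [|i s IHs] /=; rewrite ?ev_nat // evD IHs.
Qed.

Lemma ev_var i : ev (var i) = BinList.nth 0 (Pos.of_nat i.+1) env.
Proof. by rewrite [RHS](mkX_ok eqR extR ringR morphR). Qed.

(** Rewriting by relations that hold at [env] cannot change the value. The two 20s bound the number
    of rewriting rounds; soundness does not depend on them, only how far the result is reduced. *)
Lemma ev_subst (rel : seq (Z * Mon * pol)) p :
  MPcond 0 1 +%R *%R eq (fun z => (int_of_Z z)%:~R) rel env ->
  ev (PNSubstL Z0 (Zpos xH) Z.add Z.mul Z.eqb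
       (triv_div Z0 (Zpos xH) Z.eqb) p rel 20 20) = ev p.
Proof.
move=> relE; symmetry.
exact: (PNSubstL_ok eqR extR ringR morphR
  (triv_div_th eqR extR ringR morphR) 20 20 rel p env relE).
Qed.
End Evaluation.
Arguments ev : simpl never.

Definition rP : pol := var 0.
Definition riP : pol := var 1.
Definition hP (i : nat) : pol := var (i + 2).

(* The rewrite rules [r * r^-1 --> 1] and
   [h0 ^ 2 --> 1 - h1 ^ 2 - h2 ^ 2 - h3 ^ 2]. *)
Definition relations : seq (Z * Mon * pol) :=
  [:: ((Zpos xH, vmon 1 (vmon 1 mon0)), pnat 1);
      ((Zpos xH, zmon 2 (vmon 2 mon0)),
       (pnat 1 - hP 1 * hP 1 - hP 2 * hP 2 - hP 3 * hP 3)%P)].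

Definition reduce (p : pol) : pol :=
  PNSubstL Z0 (Zpos xH) Z.add Z.mul Z.eqb (triv_div Z0 (Zpos xH) Z.eqb)
    p relations 20 20.

(** A sound test: [true] yields equality wherever the relations hold, while [false] asserts
    nothing. *)
Definition same (p q : pol) : bool := is0 (reduce (p - q)%P).

Definition all7 (P : nat -> bool) := all P (iota 0 7).

Lemma all7P (P : nat -> bool) : all7 P -> forall i : 'I_7, P i.
Proof. by move=> /allP allP i; apply: allP; rewrite mem_iota ltn_ord. Qed.

(* Tabulating the tensors lets the virtual machine compute each component
   once. *)
Definition tab (T : Type) (F : nat -> T) : seq T := [seq F i | i <- iota 0 7].

Lemma nth_tab (T : Type) (x0 : T) (F : nat -> T) (i : 'I_7) :
  nth x0 (tab F) i = F i.
Proof. by rewrite (nth_map 0) ?size_iota // nth_iota. Qed.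

Definition tab2 (F : nat -> nat -> pol) := tab (fun i => tab (F i)).
Definition tab3 (F : nat -> nat -> nat -> pol) := tab (fun i => tab2 (F i)).
Definition tab4 (F : nat -> nat -> nat -> nat -> pol) :=
  tab (fun i => tab3 (F i)).
Definition get1 (t : seq pol) (i : nat) := nth (pnat 0) t i.
Definition get2 (t : seq (seq pol)) (i : nat) := get1 (nth [::] t i).
Definition get3 (t : seq (seq (seq pol))) (i : nat) := get2 (nth [::] t i).
Definition get4 (t : seq (seq (seq (seq pol)))) (i : nat) :=
  get3 (nth [::] t i).

Lemma get2_tab F (i j : 'I_7) : get2 (tab2 F) i j = F i j.
Proof. by rewrite /get2 /get1 !nth_tab. Qed.
Lemma get3_tab F (i j k : 'I_7) : get3 (tab3 F) i j k = F i j k.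
Proof. by rewrite /get3 nth_tab get2_tab. Qed.
Lemma get4_tab F (i j k l : 'I_7) : get4 (tab4 F) i j k l = F i j k l.
Proof. by rewrite /get4 nth_tab get3_tab. Qed.

(** * Polynomial counterparts of the tensors *)

Fixpoint epsP (s : seq nat) : Z :=
  if s is x :: s' then
    if x \in s' then Z0
    else if odd (count (fun y => y < x)%N s') then Z.opp (epsP s')
    else epsP s'
  else Zpos xH.

Definition dxP (a i : nat) : pol := pnat (i.+1 == a).
Definition wedge11P (al be : nat -> pol) (i j : nat) : pol :=
  (al i * be j - al j * be i)%P.
Definition wedge12P (al : nat -> pol) (om : nat -> nat -> pol) (i j k : nat) :=
  (al i * om j k + al j * om k i + al k * om i j)%P.
Definition dx2P (a b : nat) := wedge11P (dxP a) (dxP b).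
Definition e123P := wedge12P (dxP 1) (dx2P 2 3).
Definition omegaP (i a b : nat) : pol :=
  nth (pnat 0) [:: (dx2P 4 7 a b + dx2P 5 6 a b)%P;
                   (dx2P 4 6 a b - dx2P 5 7 a b)%P;
                   (dx2P 4 5 a b + dx2P 6 7 a b)%P] i.
Definition UpsilonP (i l : nat) : pol :=
  let h0 := hP 0 in let h1 := hP 1 in let h2 := hP 2 in let h3 := hP 3 in
  nth (pnat 0) (nth [::]
    [:: [:: (h0 * h0 + h1 * h1 - h2 * h2 - h3 * h3)%P;
            (pnat 2 * (h1 * h2 - h0 * h3))%P;
            (pnat 2 * (h1 * h3 + h0 * h2))%P];
        [:: (pnat 2 * (h1 * h2 + h0 * h3))%P;
            (h0 * h0 - h1 * h1 + h2 * h2 - h3 * h3)%P;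
            (pnat 2 * (h2 * h3 - h0 * h1))%P];
        [:: (pnat 2 * (h1 * h3 - h0 * h2))%P;
            (pnat 2 * (h2 * h3 + h0 * h1))%P;
            (h0 * h0 - h1 * h1 - h2 * h2 + h3 * h3)%P]] i) l.

(* The tables below have their denominators cleared: [psiT], [lcT] and
   [torsionT] contain 6 psi, 2 Lam and - 4 T. *)
Definition phiT := tab3 (fun a b c =>
  (rP * rP * rP * e123P a b c + psum 3 (fun i => psum 3 (fun l =>
     UpsilonP i l * wedge12P (dxP l.+1) (omegaP i) a b c)))%P).
Definition phiP := get3 phiT.

Definition gP (i : nat) : pol := if (i < 3)%N then (rP * rP)%P else riP.
(** The diagonal of the inverse metric; raising an index multiplies by [wP]. *)
Definition wP (i : nat) : pol := if (i < 3)%N then (riP * riP)%P else rP.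

(** The innermost contraction in [hitchin]. It does not involve the two free indices, so it is
    tabulated once for all entries. *)
Definition starT := tab4 (fun a b c d =>
  psum 7 (fun k => psum 7 (fun l => psum 7 (fun m =>
    (phiP k l m * pint (epsP [:: a; b; c; d; k; l; m]))%P)))).
Definition starP := get4 starT.
(** This is 144 times [hitchin], where 144 = 6 * (2! 2! 3!) clears the two prefactors. *)
Definition hitchinP (i j : nat) : pol :=
  psum 7 (fun a => psum 7 (fun b => (phiP i a b *
    psum 7 (fun c => psum 7 (fun d => phiP j c d * starP a b c d)))%P)).

(** The leading [rP] is the volume coefficient, and the three factors [wP] raise the indices of
    phi. *)
Definition psiT := tab4 (fun a b c d =>
  (rP * psum 7 (fun i => psum 7 (fun j => psum 7 (fun k =>
    phiP i j k * (pint (epsP [:: i; j; k; a; b; c; d]) *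
      (wP i * wP j * wP k))))))%P).
Definition psiP := get4 psiT.

Definition bracketP (i j k : nat) : pol :=
  (pnat 2 * e123P i j k + wedge12P (dxP 1) (omegaP 0) i j k
   - wedge12P (dxP 2) (omegaP 1) i j k + wedge12P (dxP 3) (omegaP 2) i j k)%P.
Definition lcT := tab3 (fun i j k =>
  (bracketP i j k * (pnat 1 + wP k * (gP j - gP i)))%P).
Definition lcP := get3 lcT.
Definition torsionT := tab2 (fun i m =>
  psum 7 (fun j => psum 7 (fun k => lcP i j k * (phiP m j k * wP j))%P)).
Definition torsionP := get2 torsionT.

(** * Tensor identities decided by computation *)

Lemma hitchinP_check : all7 (fun i => all7 (fun j =>
  same (hitchinP i j) (if i == j then pnat 144 * (rP * gP i) else pnat 0)%P)).
Proof. by vm_compute. Qed.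

Lemma torsionP_check :
  all7 (fun i => all7 (fun j => all7 (fun k => all7 (fun l => same
    (pnat 12 * psum 7 (fun m => lcP i j m * phiP m k l +
                                lcP i k m * phiP j m l +
                                lcP i l m * phiP j k m))
    (psum 7 (fun m => torsionP i m * wP m * psiP m j k l)))%P))).
Proof. by vm_compute. Qed.

(** The identity psi_mjkl psi_n^jkl = 24 g_mn of G2-structures, with 864 = 36 * 24. It makes
    contraction with psi injective, whence the uniqueness of the torsion. *)
Lemma psiP_check : all7 (fun m => all7 (fun n => same
  (psum 7 (fun j => psum 7 (fun k => psum 7 (fun l =>
     psiP m j k l * (psiP n j k l * (wP j * wP k * wP l)))))%P)
  (if m == n then pnat 864 * gP m else pnat 0)%P)).
Proof. by vm_compute. Qed.

Definition div_coefP (j : nat) : pol :=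
  nth (pnat 0)
    [:: popp (hP 2 * hP 3)%P; popp (hP 2 * hP 0)%P; (hP 2 * hP 1)%P] j.

Definition r3P := (rP * rP * rP)%P.

Lemma divP_check : all7 (fun j => same
  (psum 7 (fun i => wP i * psum 7 (fun m =>
     lcP i i m * torsionP m j + lcP i j m * torsionP i m))%P)
  (pnat 32 * (r3P - pnat 1) * (r3P + pnat 2) * riP * div_coefP j)%P).
Proof. by vm_compute. Qed.

Lemma sqnormP_check : same
  (psum 7 (fun i => psum 7 (fun j =>
     wP i * wP j * (torsionP i j * torsionP i j)))%P)
  (pnat 16 * (pnat 4 * (r3P * r3P) - pnat 14 * r3P + pnat 19 +
     pnat 8 * (r3P - pnat 1) * (r3P + pnat 2) * (hP 2 * hP 2)) * riP * riP)%P.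
Proof. by vm_compute. Qed.

(** * The Lie bracket and the adjoint action on p *)

Section Pullback.
Variables (R : realType) (A : 'I_7 -> 'I_7 -> R).

Definition pull1 (t : tensor1 R) : tensor1 R := fun i =>
  \sum_a A i a * t a.
Definition pull2 (t : tensor2 R) : tensor2 R := fun i j =>
  \sum_a \sum_b A i a * A j b * t a b.
Definition pull3 (t : tensor3 R) : tensor3 R := fun i j k =>
  \sum_a \sum_b \sum_c A i a * A j b * A k c * t a b c.

Lemma sum_mul2 (F G : 'I_7 -> R) :
  \sum_a \sum_b F a * G b = (\sum_a F a) * (\sum_b G b).
Proof. by rewrite mulr_suml; apply: eq_bigr => a _; rewrite mulr_sumr. Qed.

Lemma sum_mul12 (F : 'I_7 -> R) (G : 'I_7 -> 'I_7 -> R) :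
  \sum_a \sum_b \sum_c F a * G b c = (\sum_a F a) * (\sum_b \sum_c G b c).
Proof.
rewrite mulr_suml; apply: eq_bigr => a _; rewrite mulr_sumr.
by apply: eq_bigr => b _; rewrite mulr_sumr.
Qed.

(** Pullback commutes with wedge products, so the invariance of a form built by wedges is checked on
    its factors. *)
Lemma pull2_wedge (al be : tensor1 R) i j :
  pull2 (wedge11 al be) i j = wedge11 (pull1 al) (pull1 be) i j.
Proof.
rewrite /wedge11 /pull1 -!sum_mul2.
rewrite [X in _ = _ - X]exchange_big -sumrB; apply: eq_bigr => a _.
by rewrite -sumrB; apply: eq_bigr => b _; ring.
Qed.

Lemma pull3_wedge (al : tensor1 R) (om : tensor2 R) i j k :
  pull3 (wedge12 al om) i j k = wedge12 (pull1 al) (pull2 om) i j k.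
Proof.
(* The three terms of [wedge12] carry cyclically permuted indices; rotating the sums aligns their
   dummy variables. *)
have rot (F : 'I_7 -> 'I_7 -> 'I_7 -> R) :
    \sum_a \sum_b \sum_c F a b c = \sum_b \sum_c \sum_a F a b c.
  rewrite exchange_big; apply: eq_bigr => b _; exact: exchange_big.
rewrite /wedge12 /pull1 /pull2 -!sum_mul12 [X in _ + X + _]rot.
rewrite [X in _ + X + _]rot [X in _ + X]rot -!big_split.
apply: eq_bigr => a _; rewrite -!big_split; apply: eq_bigr => b _.
by rewrite -!big_split; apply: eq_bigr => c _ /=; ring.
Qed.

Lemma pull2D (s t : tensor2 R) i j :
  pull2 (fun a b => s a b + t a b) i j = pull2 s i j + pull2 t i j.
Proof.
rewrite -big_split; apply: eq_bigr => a _; rewrite -big_split.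
by apply: eq_bigr => b _; rewrite mulrDr.
Qed.

Lemma pull2N (s : tensor2 R) i j :
  pull2 (fun a b => - s a b) i j = - pull2 s i j.
Proof.
rewrite -sumrN; apply: eq_bigr => a _; rewrite -sumrN.
by apply: eq_bigr => b _; rewrite mulrN.
Qed.

Lemma pull3D (s t : tensor3 R) i j k :
  pull3 (fun a b c => s a b c + t a b c) i j k = pull3 s i j k + pull3 t i j k.
Proof.
rewrite -big_split; apply: eq_bigr => a _; rewrite -big_split.
apply: eq_bigr => b _; rewrite -big_split; apply: eq_bigr => c _.
by rewrite mulrDr.
Qed.

Lemma pull3Z x (s : tensor3 R) i j k :
  pull3 (fun a b c => x * s a b c) i j k = x * pull3 s i j k.
Proof.
rewrite mulr_sumr; apply: eq_bigr => a _; rewrite mulr_sumr.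
apply: eq_bigr => b _; rewrite mulr_sumr; apply: eq_bigr => c _.
by rewrite mulrCA.
Qed.

Lemma pull3_sum n (F : 'I_n -> tensor3 R) i j k :
  pull3 (fun a b c => \sum_l F l a b c) i j k = \sum_l pull3 (F l) i j k.
Proof.
rewrite [RHS]exchange_big; apply: eq_bigr => a _; rewrite [RHS]exchange_big.
apply: eq_bigr => b _; rewrite [RHS]exchange_big; apply: eq_bigr => c _.
by rewrite mulr_sumr.
Qed.
End Pullback.

(** * Coordinate formulas for the bracket and for Ad *)

Section BracketAndAd.
Variable R : realType.

Local Notation s := ((Num.sqrt 2)^-1 : R).

Lemma sqr_sqrt2 : Num.sqrt 2 ^+ 2 = 2 :> R.
Proof. by rewrite sqr_sqrtr ?ler0n. Qed.

Lemma sqrt2_neq0 : Num.sqrt 2 != 0 :> R.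
Proof. by rewrite gt_eqF // sqrtr_gt0 ltr0n. Qed.

(** The general element of p: the lower left entry is minus the conjugate of the upper right one,
    and the lower right entry is imaginary. *)
Definition p_mx (x1 x2 x3 x4 x5 x6 x7 : R) : 'M[quat R]_2 :=
  mx22 0 (Quat x7 x4 x5 x6) (Quat (- x7) x4 x5 x6) (Quat 0 x1 x2 x3).

Lemma basis_pE (i : 'I_7) : basis_p R i =
  p_mx (dx R 1 i) (dx R 2 i) (dx R 3 i) (s * dx R 4 i) (s * dx R 5 i)
    (s * dx R 6 i) (s * dx R 7 i).
Proof.
case: i => [[|[|[|[|[|[|[|i]]]]]]] // ilt];
  by rewrite /basis_p /p_mx /dx /= ?mulr1 ?mulr0 ?oppr0.
Qed.

Lemma quatDE (a b : quat R) : a + b = qadd a b. Proof. by []. Qed.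
Lemma quatNE (a : quat R) : - a = qopp a. Proof. by []. Qed.
Lemma quatME (a b : quat R) : a * b = qmul a b. Proof. by []. Qed.
Lemma quat0E : (0 : quat R) = Quat 0 0 0 0. Proof. by []. Qed.

Lemma mx22M a b c d a' b' c' d' :
  mx22 a b c d *m mx22 a' b' c' d' =
  mx22 (a * a' + b * c') (a * b' + b * d') (c * a' + d * c') (c * b' + d * d')
    :> 'M[quat R]_2.
Proof.
apply/matrixP => -[[|[|i]] // ?] [[|[|j]] // ?];
  by rewrite !mxE !big_ord_recl big_ord0 !mxE /= addr0.
Qed.

Lemma mx22B a b c d a' b' c' d' :
  mx22 a b c d - mx22 a' b' c' d' = mx22 (a - a') (b - b') (c - c') (d - d')
    :> 'M[quat R]_2.
Proof.
by apply/matrixP => -[[|[|i]] // ?] [[|[|j]] // ?]; rewrite !mxE.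
Qed.

Lemma adjoint_mx22 (a b c d : quat R) :
  adjoint (mx22 a b c d) = mx22 (qconj a) (qconj c) (qconj b) (qconj d).
Proof.
by apply/matrixP => -[[|[|i]] // ?] [[|[|j]] // ?]; rewrite !mxE.
Qed.

Lemma inner_mx22 (a b c d a' b' c' d' : quat R) :
  inner (mx22 a b c d) (mx22 a' b' c' d') =
  q0 (qconj a * a' + qconj c * c' + (qconj b * b' + qconj d * d')).
Proof.
rewrite /inner adjoint_mx22 mx22M /mxtrace !big_ord_recl big_ord0 !mxE /=.
by rewrite addr0.
Qed.

(** The indices stay symbolic inside [dx], so a single identity in a field with (sqrt 2)^2 = 2
    covers all triples of basis vectors. *)
Lemma bracket_pE (i j k : 'I_7) : bracket_p R i j k =
  2 * e123 R i j k + wedge12 (dx R 1) (omega R 0) i j k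
  - wedge12 (dx R 2) (omega R 1) i j k + wedge12 (dx R 3) (omega R 2) i j k.
Proof.
rewrite /bracket_p !basis_pE /lie /p_mx !mx22M mx22B inner_mx22.
rewrite !(quatDE, quatME, quatNE) !quat0E /=.
rewrite /e123 /wedge12 /omega /dx2 /wedge11 /=.
by field: sqr_sqrt2; rewrite sqrt2_neq0.
Qed.

(** Conjugation by diag(u, 1) fixes e_1, e_2, e_3 and multiplies the upper right entry by u on the
    left. That entry has real part along e_7 and imaginary parts along e_4, e_5, e_6. *)
Definition Ad_dx (u : quat R) (n : nat) : tensor1 R := fun i =>
  match n with
  | 4 => q0 u * dx R 4 i + q1 u * dx R 7 i + q2 u * dx R 6 i - q3 u * dx R 5 i
  | 5 => q0 u * dx R 5 i - q1 u * dx R 6 i + q2 u * dx R 7 i + q3 u * dx R 4 i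
  | 6 => q0 u * dx R 6 i + q1 u * dx R 5 i - q2 u * dx R 4 i + q3 u * dx R 7 i
  | 7 => q0 u * dx R 7 i - q1 u * dx R 4 i - q2 u * dx R 5 i - q3 u * dx R 6 i
  | _ => dx R n i
  end.

Lemma Ad_pE (u : quat R) (i k : 'I_7) :
  Ad_p u i k = \sum_(n < 7) Ad_dx u n.+1 i * dx R n.+1 k.
Proof.
rewrite /Ad_p !basis_pE /p_mx adjoint_mx22 !mx22M inner_mx22.
rewrite !(quatDE, quatME, quatNE) !quat0E /= !big_ord_recl big_ord0 /=.
by field: sqr_sqrt2; rewrite sqrt2_neq0.
Qed.

Lemma dxE (n m : 'I_7) : dx R n.+1 m = (m == n)%:R.
Proof. by rewrite /dx eqSS. Qed.

Lemma sum_dx (F : 'I_7 -> R) (n : 'I_7) : \sum_a F a * dx R n.+1 a = F n.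
Proof.
rewrite (bigD1 n) //= big1 => [|a /negPf an].
  by rewrite dxE eqxx mulr1 addr0.
by rewrite dxE an mulr0.
Qed.

Lemma sum_Ad_dx (u : quat R) (i n : 'I_7) :
  \sum_a Ad_p u i a * dx R n.+1 a = Ad_dx u n.+1 i.
Proof.
rewrite sum_dx Ad_pE -[RHS](sum_dx (fun m : 'I_7 => Ad_dx u m.+1 i) n).
by apply: eq_bigr => m _; rewrite !dxE eq_sym.
Qed.

Lemma qnormE (u : quat R) : u * qconj u = 1 ->
  q0 u ^+ 2 = 1 - q1 u ^+ 2 - q2 u ^+ 2 - q3 u ^+ 2.
Proof. by rewrite quatME => -[+ _ _ _] /=; move=> <-; ring. Qed.

Lemma Ad_pull1_dx u (n : 'I_7) i :
  pull1 (Ad_p u) (dx R n.+1) i = Ad_dx u n.+1 i.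
Proof. exact: sum_Ad_dx. Qed.

(** Up to sign the omega_n are the forms <b i, b'>, <b j, b'>, <b k, b'> on the quaternions. Left
    multiplication by a unit quaternion commutes with right multiplications and is an isometry, so
    it preserves them. *)
Lemma Ad_pull2_omega (u : quat R) (n : 'I_3) i j : u * qconj u = 1 ->
  pull2 (Ad_p u) (omega R n) i j = omega R n i j.
Proof.
move=> /qnormE u1.
have pull_dx2 (a b : 'I_7) : pull2 (Ad_p u) (dx2 R a.+1 b.+1) i j =
  Ad_dx u a.+1 i * Ad_dx u b.+1 j - Ad_dx u a.+1 j * Ad_dx u b.+1 i.
  by rewrite pull2_wedge /wedge11 !Ad_pull1_dx.
have := (pull_dx2 3 6, pull_dx2 4 5, pull_dx2 3 5, pull_dx2 4 6,
         pull_dx2 3 4, pull_dx2 5 6).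
rewrite /= => pE.
case: n => [[|[|[|n]]] // nlt];
  by rewrite /omega /= pull2D ?pull2N !pE /dx2 /wedge11; ring: u1.
Qed.

Lemma Ad_invariant_phi (r : R) (h : 'rV[R]_4) : Ad_invariant (phi_ r h).
Proof.
move=> u u1 i j k.
have wedgeE (l n : 'I_3) a b c :
    pull3 (Ad_p u) (wedge12 (dx R l.+1) (omega R n)) a b c =
    wedge12 (dx R l.+1) (omega R n) a b c.
  have lE : (l < 7)%N := leq_trans (ltn_ord l) (isT : (3 <= 7)%N).
  rewrite pull3_wedge /wedge12 !Ad_pull2_omega //.
  by rewrite !(Ad_pull1_dx _ (Ordinal lE)) /=; case: l {lE} => [[|[|[|l]]]].
have e123E : pull3 (Ad_p u) (e123 R) i j k = e123 R i j k.
  rewrite pull3_wedge /e123 /wedge12 !pull2_wedge /dx2 /wedge11.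
  by rewrite !(Ad_pull1_dx _ 0) !(Ad_pull1_dx _ 1) !(Ad_pull1_dx _ 2).
transitivity (pull3 (Ad_p u) (phi_ r h) i j k); first by [].
rewrite pull3D pull3Z e123E pull3_sum; congr (_ + _).
apply: eq_bigr => n _; rewrite pull3_sum; apply: eq_bigr => l _.
by rewrite pull3Z wedgeE.
Qed.
End BracketAndAd.

(** * The Levi-Civita connection of [g_ r] *)

Section LeviCivita.
Variables (R : realType) (r : R).
Hypothesis r0 : r != 0.

Definition gdiag (i : 'I_7) : R := if (i < 3)%N then r ^+ 2 else r^-1.
Definition wdiag (i : 'I_7) : R := if (i < 3)%N then r^-1 ^+ 2 else r.

Lemma wdiagE i : wdiag i = (gdiag i)^-1.
Proof. by rewrite /wdiag /gdiag; case: ifP => _; rewrite ?exprVn ?invrK. Qed.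

Lemma gdiag_neq0 i : gdiag i != 0.
Proof. by rewrite /gdiag; case: ifP => _; rewrite ?expf_neq0 ?invr_eq0. Qed.

Lemma g_E i j : g_ r i j = if i == j then gdiag i else 0.
Proof. by rewrite mxE. Qed.

Lemma sum_g (F : 'I_7 -> R) k : \sum_m F m * g_ r m k = F k * gdiag k.
Proof.
rewrite (bigD1 k) //= big1 => [|m /negPf mk]; rewrite g_E ?eqxx ?addr0 //.
by rewrite mk mulr0.
Qed.

Lemma g_sym i j : g_ r i j = g_ r j i.
Proof. by rewrite !g_E eq_sym; case: eqP => // ->. Qed.

Lemma invmx_gE i j : invmx (g_ r) i j = if i == j then wdiag i else 0.
Proof.
pose W : 'M[R]_7 := \matrix_(i, j) if i == j then wdiag i else 0.
have WM : W *m g_ r = 1%:M.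
  apply/matrixP => a b; rewrite mxE sum_g !mxE.
  case: eqP => [->|_]; last by rewrite mul0r.
  by rewrite wdiagE mulVf ?gdiag_neq0.
have [_ gU] := mulmx1_unit WM.
by rewrite -[invmx _]mul1mx -WM mulmxK // mxE.
Qed.

(** The Koszul formula for a diagonal metric: as the bracket is totally skew, its three terms
    combine into br_ijk (g_k + g_j - g_i). *)
Definition lc : tensor3 R := fun i j k =>
  2^-1 * (bracket_p R i j k * (1 + wdiag k * (gdiag j - gdiag i))).

Lemma bracket_anti i j k : bracket_p R j i k = - bracket_p R i j k.
Proof. by rewrite !bracket_pE /omega /e123 /dx2 /wedge12 /wedge11 /=; ring. Qed.

Lemma bracket_anti23 i j k : bracket_p R i k j = - bracket_p R i j k.
Proof. by rewrite !bracket_pE /omega /e123 /dx2 /wedge12 /wedge11 /=; ring. Qed.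

Lemma is_levi_civitaP (L : tensor3 R) : is_levi_civita (g_ r) L <->
  (forall i j k, L i j k - L j i k = bracket_p R i j k) /\
  (forall i j k, L i j k * gdiag k + L i k j * gdiag j = 0).
Proof.
have E i j k : \sum_m (L i j m * g_ r m k + L i k m * g_ r j m) =
    L i j k * gdiag k + L i k j * gdiag j.
  rewrite big_split sum_g; congr (_ + _).
  by under eq_bigr do rewrite g_sym; rewrite sum_g.
by split=> -[Ltor Lg]; split=> // i j k; have := Lg i j k; rewrite E.
Qed.

Lemma lc_levi_civita : is_levi_civita (g_ r) lc.
Proof.
apply/is_levi_civitaP; split=> i j k; rewrite /lc !wdiagE.
  by rewrite (bracket_anti i j); field; rewrite gdiag_neq0.
by rewrite (bracket_anti23 i j k); field; rewrite !gdiag_neq0.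
Qed.

(** The difference [D] of two solutions is symmetric in its first two indices and, once the last is
    lowered, skew in its last two. Alternating the two exchanges three times returns to the same
    indices with the opposite sign. *)
Lemma levi_civita_unique L : is_levi_civita (g_ r) L -> L = lc.
Proof.
move=> /is_levi_civitaP[Ltor Lg].
have /is_levi_civitaP[ltor lg] := lc_levi_civita.
pose D i j k := L i j k - lc i j k.
have Dsym i j k : D i j k = D j i k.
  by have := Ltor i j k; rewrite -(ltor i j k) /D; lra.
have Danti i j k : D i j k * gdiag k = - (D i k j * gdiag j).
  by have := Lg i j k; have := lg i j k; rewrite /D; lra.
have D0 i j k : D i j k = 0.
  have E : D i j k * gdiag k = - (D i j k * gdiag k).
    by rewrite {1}Danti (Dsym i k) Danti opprK (Dsym k j) Danti (Dsym j i).
  by apply: (mulIf (gdiag_neq0 k)); move: E; rewrite mul0r; lra.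
apply/funext => i; apply/funext => j; apply/funext => k; apply/eqP.
by rewrite -subr_eq0; apply/eqP; apply: D0.
Qed.

Lemma levi_civitaE : levi_civita (g_ r) = lc.
Proof.
apply: xget_unique; first exact: lc_levi_civita.
exact: levi_civita_unique.
Qed.
End LeviCivita.

(** * The torsion of [phi_ r h] *)

Lemma sum4 (R : nmodType) (F : 'I_4 -> R) : \sum_i F i = F 0 + F 1 + F 2 + F 3.
Proof.
rewrite !big_ord_recl big_ord0 addr0 !addrA.
by do !congr (_ + _); congr F; apply/val_inj.
Qed.

Section Reflection.
Variables (R : realType) (r : R) (h : 'rV[R]_4).
Hypothesis hr : 0 < r.
Let r0 : r != 0 := lt0r_neq0 hr.
Hypothesis hS : sphere3 h.

(** The order is that of the variables [rP], [riP], [hP 0], ..., [hP 3]. *)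
Definition env : seq R := [:: r; r^-1; h 0 0; h 0 1; h 0 2; h 0 3].
Local Notation ev := (ev env).

Lemma ev_vars : (ev rP = r) * (ev riP = r^-1) *
  ((ev (hP 0) = h 0 0) * (ev (hP 1) = h 0 1) * (ev (hP 2) = h 0 2) *
   (ev (hP 3) = h 0 3)).
Proof. by rewrite !ev_var. Qed.

Lemma sphere3E : h 0 0 ^+ 2 + h 0 1 ^+ 2 + h 0 2 ^+ 2 + h 0 3 ^+ 2 = 1.
Proof. by rewrite -hS sum4. Qed.

(** Both relations hold at [env]: the first because r is nonzero, the second because h lies on the
    unit sphere. *)
Lemma ev_reduce p : ev (reduce p) = ev p.
Proof.
apply: ev_subst; split; last split=> //; rewrite -/(ev _).
  by rewrite ev_nat /= mulr1z !mul1r mulVf.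
rewrite !evB !evM !ev_vars ev_nat /= mulr1z !mul1r -[1%:R]sphere3E.
by ring.
Qed.

Lemma ev_same p q : same p q -> ev p = ev q.
Proof.
move=> /(is0P env); rewrite ev_reduce evB => /eqP.
by rewrite subr_eq0 => /eqP.
Qed.

Lemma ev_dx a (i : 'I_7) : ev (dxP a i) = dx R a i.
Proof. exact: ev_nat. Qed.

Lemma ev_dx2 a b (i j : 'I_7) : ev (dx2P a b i j) = dx2 R a b i j.
Proof. by rewrite evB !evM !ev_dx. Qed.

Lemma ev_wedge12 a (om : nat -> nat -> pol) (om' : tensor2 R) (i j k : 'I_7) :
  (forall i j : 'I_7, ev (om i j) = om' i j) ->
  ev (wedge12P (dxP a) om i j k) = wedge12 (dx R a) om' i j k.
Proof. by move=> omE; rewrite !evD !evM !ev_dx !omE. Qed.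

Lemma ev_e123 (i j k : 'I_7) : ev (e123P i j k) = e123 R i j k.
Proof. exact/ev_wedge12/ev_dx2. Qed.

Lemma ev_omega (n : 'I_3) (i j : 'I_7) : ev (omegaP n i j) = omega R n i j.
Proof.
case: n => [[|[|[|n]]] // ?]; rewrite /omegaP /omega /=.
- by rewrite evD !ev_dx2.
- by rewrite evB !ev_dx2.
- by rewrite evD !ev_dx2.
Qed.

Lemma ev_Upsilon (i l : 'I_3) : ev (UpsilonP i l) = Upsilon h i l.
Proof.
rewrite mxE; case: i l => [[|[|[|i]]] // ?] [[|[|[|l]]] // ?];
  by rewrite /UpsilonP /= !(evB, evD, evM, ev_nat, ev_vars) /=; ring.
Qed.

Lemma ev_phi (i j k : 'I_7) : ev (phiP i j k) = phi_ r h i j k.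
Proof.
rewrite /phiP get3_tab evD !evM ev_e123 !ev_vars ev_sum /phi_; congr (_ + _).
  by rewrite !exprS expr0 mulr1 !mulrA.
apply: eq_bigr => n _; rewrite ev_sum; apply: eq_bigr => l _.
by rewrite evM ev_Upsilon (ev_wedge12 _ _ _ _ (ev_omega n)).
Qed.

Lemma ev_eps (s : seq 'I_7) : ev (pint (epsP (map val s))) = epsilon R s.
Proof.
elim: s => //= x s IHs; rewrite (mem_map val_inj) count_map.
case: ifP => // _; rewrite -IHs -signr_odd.
by case: odd; rewrite ?mul1r // mulN1r -evN.
Qed.

Lemma ev_star (a b c d : 'I_7) : ev (starP a b c d) =
  \sum_k \sum_l \sum_m phi_ r h k l m * epsilon R [:: a; b; c; d; k; l; m].
Proof.
rewrite /starP get4_tab ev_sum; apply: eq_bigr => k _.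
rewrite ev_sum; apply: eq_bigr => l _; rewrite ev_sum; apply: eq_bigr => m _.
by rewrite evM ev_phi -ev_eps.
Qed.

Lemma ev_hitchin (i j : 'I_7) :
  ev (hitchinP i j) = 144 * hitchin (phi_ r h) i j.
Proof.
rewrite mxE; set S := \sum_a _.
have -> : 144 * (6^-1 * ((2`! * 2`! * 3`!)%N%:R^-1 * S)) = S.
  by rewrite /factorial /=; field.
rewrite ev_sum; apply: eq_bigr => a _; rewrite ev_sum; apply: eq_bigr => b _.
rewrite evM ev_phi ev_sum mulr_sumr; apply: eq_bigr => c _.
rewrite ev_sum mulr_sumr; apply: eq_bigr => d _.
rewrite evM ev_phi ev_star !mulr_sumr; apply: eq_bigr => k _.
rewrite !mulr_sumr; apply: eq_bigr => l _; rewrite !mulr_sumr.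
by apply: eq_bigr => m _; ring.
Qed.

Lemma ev_g (i : 'I_7) : ev (gP i) = gdiag r i.
Proof. by rewrite /gP /gdiag; case: ifP; rewrite ?evM !ev_vars. Qed.

Lemma ev_w (i : 'I_7) : ev (wP i) = wdiag r i.
Proof. by rewrite /wP /wdiag; case: ifP; rewrite ?evM !ev_vars. Qed.

Lemma hitchin_phi : hitchin (phi_ r h) = r *: g_ r.
Proof.
apply/matrixP => i j; rewrite [RHS]mxE g_E.
have /ev_same := all7P (all7P hitchinP_check i) j.
rewrite ev_hitchin -val_eqE; case: ifP => _.
  by rewrite !evM ev_nat ev_vars ev_g => /mulfI; apply; rewrite pnatr_eq0.
by rewrite ev_nat mulr0 => /eqP; rewrite mulf_eq0 pnatr_eq0 => /eqP.
Qed.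

Lemma det_g : \det (g_ r) = r ^+ 2.
Proof.
have -> : g_ r = diag_mx (\row_i gdiag r i).
  by apply/matrixP => i j; rewrite g_E !mxE; case: eqP.
rewrite det_diag !big_ord_recl big_ord0 !mxE /gdiag /=.
by field.
Qed.

(** The determinant of r g_r is r^7 r^2 = r^9, whose ninth root is r since r > 0. *)
Lemma vol_coef_phi : vol_coef (phi_ r h) = r.
Proof.
rewrite /vol_coef hitchin_phi detZ det_g -exprD gtr0_sg ?exprn_gt0 // mul1r.
rewrite ger0_norm ?exprn_ge0 ?ltW // -powR_mulrn ?ltW // -powRrM.
by rewrite mulfV ?pnatr_eq0 // powRr1 ?ltW.
Qed.

Lemma induced_metric_phi : induced_metric (phi_ r h) = g_ r.
Proof.
by rewrite /induced_metric vol_coef_phi hitchin_phi scalerA mulVf ?scale1r.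
Qed.

Lemma inv_metric_phi i j :
  inv_metric (phi_ r h) i j = if i == j then wdiag r i else 0.
Proof. by rewrite /inv_metric induced_metric_phi invmx_gE. Qed.

Lemma sum_inv_metric (F : 'I_7 -> R) i :
  \sum_j inv_metric (phi_ r h) i j * F j = wdiag r i * F i.
Proof.
rewrite (bigD1 i) //= big1 => [|j /negPf ji].
  by rewrite inv_metric_phi eqxx addr0.
by rewrite inv_metric_phi eq_sym ji mul0r.
Qed.

Lemma ev_psi (a b c d : 'I_7) :
  ev (psiP a b c d) = 6 * hodge_psi (phi_ r h) a b c d.
Proof.
rewrite /psiP get4_tab /hodge_psi vol_coef_phi -[(3`!)%:R]/6 !mulrA.
rewrite divff ?mul1r ?pnatr_eq0 // evM ev_vars; congr (_ * _).
rewrite ev_sum; apply: eq_bigr => i _; rewrite ev_sum; apply: eq_bigr => j _.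
rewrite ev_sum; apply: eq_bigr => k _.
(* Nesting the sums lets each contraction with the diagonal inverse metric collapse to one term. *)
transitivity (\sum_i' inv_metric (phi_ r h) i i' *
  \sum_j' inv_metric (phi_ r h) j j' *
  \sum_k' inv_metric (phi_ r h) k k' *
    (phi_ r h i' j' k' * epsilon R [:: i; j; k; a; b; c; d])).
  rewrite !sum_inv_metric !evM ev_phi !ev_w -ev_eps; ring.
apply: eq_bigr => i' _; rewrite mulr_sumr; apply: eq_bigr => j' _.
by rewrite mulrA mulr_sumr; apply: eq_bigr => k' _; rewrite !mulrA.
Qed.

Lemma ev_bracket (i j k : 'I_7) : ev (bracketP i j k) = bracket_p R i j k.
Proof.
rewrite bracket_pE evD evB evD evM ev_nat ev_e123.
by rewrite (ev_wedge12 _ _ _ _ (ev_omega 0)) (ev_wedge12 _ _ _ _ (ev_omega 1))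
  (ev_wedge12 _ _ _ _ (ev_omega 2)).
Qed.

Lemma ev_lc (i j k : 'I_7) : ev (lcP i j k) = 2 * lc r i j k.
Proof.
rewrite /lcP get3_tab evM ev_bracket evD evM evB ev_nat ev_w !ev_g /lc.
by rewrite mulrA divff ?mul1r ?pnatr_eq0.
Qed.

Definition torsion : 'M[R]_7 := \matrix_(i, m)
  (- 2^-1 * \sum_j \sum_k lc r i j k * (phi_ r h m j k * wdiag r j)).

Lemma ev_torsion (i m : 'I_7) : ev (torsionP i m) = - 4 * torsion i m.
Proof.
rewrite mxE mulrA; have -> : - 4 * - 2^-1 = 2 :> R by field.
rewrite /torsionP get2_tab ev_sum mulr_sumr; apply: eq_bigr => j _.
rewrite ev_sum mulr_sumr; apply: eq_bigr => k _.
by rewrite !evM ev_lc ev_phi ev_w -!mulrA.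
Qed.

Lemma mul_inv_metric (T : 'M[R]_7) i m :
  (T *m inv_metric (phi_ r h)) i m = T i m * wdiag r m.
Proof.
rewrite mxE (bigD1 m) //= big1 => [|j /negPf jm].
  by rewrite inv_metric_phi eqxx addr0.
by rewrite inv_metric_phi jm mulr0.
Qed.

Lemma torsion_full : is_full_torsion (phi_ r h) torsion.
Proof.
move=> i j k l; rewrite induced_metric_phi levi_civitaE //.
have /ev_same := all7P (all7P (all7P (all7P torsionP_check i) j) k) l.
rewrite evM ev_nat !ev_sum /nabla3 => E.
(* On the right, -24 = (-4) * 6 from -4 T and 6 psi. On the left, 12 multiplies 2 [lc], and [nabla3]
   carries a minus sign. *)
apply: (@mulfI _ (-24)); first by rewrite oppr_eq0 pnatr_eq0.
rewrite mulrN mulNr opprK.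
transitivity (12 * \sum_(m < 7) ev (lcP i j m * phiP m k l +
    lcP i k m * phiP j m l + lcP i l m * phiP j k m)%P).
  rewrite !mulr_sumr; apply: eq_bigr => m _.
  by rewrite !evD !evM !ev_lc !ev_phi; ring.
rewrite E mulr_sumr; apply: eq_bigr => m _.
by rewrite !evM ev_torsion ev_w ev_psi mul_inv_metric; ring.
Qed.

(** The i-th row [S] of the difference, with its index raised, contracts to zero with psi.
    Contracting once more with psi_n, indices raised in [X], gives 24 S^n g_nn = 0. *)
Lemma full_torsion_unique T : is_full_torsion (phi_ r h) T -> T = torsion.
Proof.
move=> TP; apply/matrixP => i n; apply/eqP; rewrite -subr_eq0; apply/eqP.
pose S m := (T i m - torsion i m) * wdiag r m.
have S0 j k l : \sum_m S m * hodge_psi (phi_ r h) m j k l = 0.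
  have := TP i j k l; rewrite torsion_full => /esym/eqP.
  rewrite -subr_eq0 -sumrB => /eqP E; rewrite -[RHS]E; apply: eq_bigr => m _.
  by rewrite !mul_inv_metric /S; ring.
pose X j k l :=
  hodge_psi (phi_ r h) n j k l * (wdiag r j * wdiag r k * wdiag r l).
have: \sum_m S m *
    (36 * \sum_j \sum_k \sum_l hodge_psi (phi_ r h) m j k l * X j k l) = 0.
  transitivity (\sum_m \sum_j \sum_k \sum_l
      36 * (S m * hodge_psi (phi_ r h) m j k l * X j k l)).
    apply: eq_bigr => m _; rewrite !mulr_sumr; apply: eq_bigr => j _.
    rewrite !mulr_sumr; apply: eq_bigr => k _; rewrite !mulr_sumr.
    by apply: eq_bigr => l _; ring.
  rewrite exchange_big big1 // => j _; rewrite exchange_big big1 // => k _.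
  rewrite exchange_big big1 // => l _.
  by rewrite -mulr_sumr -mulr_suml S0 mul0r mulr0.
have E m : 36 * \sum_j \sum_k \sum_l hodge_psi (phi_ r h) m j k l * X j k l =
    if m == n then 864 * gdiag r m else 0.
  transitivity (ev (if m == n :> nat then pnat 864 * gP m else pnat 0)%P);
    last first.
    by rewrite val_eqE; case: ifP => _; rewrite ?evM ev_nat ?ev_g.
  rewrite -(ev_same (all7P (all7P psiP_check m) n)).
  rewrite ev_sum mulr_sumr; apply: eq_bigr => j _.
  rewrite ev_sum mulr_sumr; apply: eq_bigr => k _.
  rewrite ev_sum mulr_sumr; apply: eq_bigr => l _.
  by rewrite !evM !ev_psi !ev_w /X; ring.
under eq_bigr do rewrite E.
rewrite (bigD1 n) //= big1 => [|m /negPf ->]; last by rewrite mulr0.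
rewrite eqxx addr0 /S wdiagE => /eqP.
have gn := gdiag_neq0 r0 n.
by rewrite !mulf_eq0 invr_eq0 pnatr_eq0 (negPf gn) /= !orbF => /eqP.
Qed.

Lemma full_torsionE : full_torsion (phi_ r h) = torsion.
Proof.
apply: xget_unique; first exact: torsion_full.
exact: full_torsion_unique.
Qed.

(** * Closed forms of the divergence, the torsion norm and the energy *)

Lemma div_torsionE (j : 'I_7) : div_torsion (phi_ r h) j =
  4 * (r ^+ 3 - 1) * (r ^+ 3 + 2) / r *
  nth 0 [:: - (h 0 2 * h 0 3); - (h 0 2 * h 0 0); h 0 2 * h 0 1] j.
Proof.
(* Here 8 = - (2 * (-4)): [lcP] is 2 Lam, [torsionP] is -4 T, and [nabla2] carries a minus sign. *)
apply: (@mulfI _ 8); first by rewrite pnatr_eq0.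
have /ev_same E := all7P divP_check j.
transitivity (ev (psum 7 (fun i => wP i * psum 7 (fun m =>
     lcP i i m * torsionP m j + lcP i j m * torsionP i m))%P)).
  rewrite ev_sum mulr_sumr; apply: eq_bigr => i _.
  rewrite sum_inv_metric evM ev_w ev_sum mulrCA; congr (_ * _).
  rewrite induced_metric_phi levi_civitaE // full_torsionE /nabla2.
  rewrite mulrN -mulNr mulr_sumr; apply: eq_bigr => m _.
  by rewrite evD !evM !ev_lc !ev_torsion; ring.
rewrite E !evM evB evD !evM !ev_nat !ev_vars.
transitivity (32 * (r * r * r - 1) * (r * r * r + 2) * r^-1 *
  nth 0 [:: - (h 0 2 * h 0 3); - (h 0 2 * h 0 0); h 0 2 * h 0 1] j);
  last by ring.
congr (_ * _); rewrite /div_coefP.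
(* For the components along e_4, ..., e_7 both lists are exhausted and give their default value
   0. *)
by case: j {E} => [[|[|[|j]]] ?] /=;
  rewrite ?nth_nil ?evN ?evM ?ev_vars ?ev_nat.
Qed.

Lemma sqnorm_torsionE : sqnorm_torsion (phi_ r h) =
  (4 * r ^+ 6 - 14 * r ^+ 3 + 19 +
    8 * (r ^+ 3 - 1) * (r ^+ 3 + 2) * h 0 2 ^+ 2) / r ^+ 2.
Proof.
apply: (@mulfI _ 16); first by rewrite pnatr_eq0.
have /ev_same E := sqnormP_check.
transitivity (ev (psum 7 (fun i => psum 7 (fun j =>
     wP i * wP j * (torsionP i j * torsionP i j)))%P)).
  rewrite ev_sum mulr_sumr; apply: eq_bigr => i _.
  rewrite ev_sum mulr_sumr; apply: eq_bigr => j _.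
  rewrite full_torsionE.
  transitivity (16 * \sum_k inv_metric (phi_ r h) i k *
    \sum_l inv_metric (phi_ r h) j l * (torsion i j * torsion k l)).
    congr (_ * _); apply: eq_bigr => k _; rewrite mulr_sumr.
    by apply: eq_bigr => l _; ring.
  by rewrite !sum_inv_metric !evM !ev_w ev_torsion; ring.
rewrite E !(evM, evD, evB, ev_vars, ev_nat).
by field.
Qed.

Lemma energyE : energy (phi_ r h) =
  2^-1 * total_volume R / r * (4 * r ^+ 6 - 14 * r ^+ 3 + 19 +
    8 * (r ^+ 3 - 1) * (r ^+ 3 + 2) * h 0 2 ^+ 2).
Proof.
rewrite /energy sqnorm_torsionE vol_coef_phi gtr0_norm //.
by field.
Qed.

End Reflection.

(** * Harmonic structures and critical points *)

Section Parametrisation.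
Variables (R : realType) (r : R).
Hypothesis hr : 0 < r.
Implicit Types h v : 'rV[R]_4.

Lemma eq_rV4 h h' : h 0 0 = h' 0 0 -> h 0 1 = h' 0 1 -> h 0 2 = h' 0 2 ->
  h 0 3 = h' 0 3 -> h = h'.
Proof.
move=> e0 e1 e2 e3; apply/rowP => -[[|[|[|[|k]]]] // ilt].
- by move: e0; congr (h 0 _ = h' 0 _); apply/val_inj.
- by move: e1; congr (h 0 _ = h' 0 _); apply/val_inj.
- by move: e2; congr (h 0 _ = h' 0 _); apply/val_inj.
- by move: e3; congr (h 0 _ = h' 0 _); apply/val_inj.
Qed.

Lemma phi_opp h : phi_ r (- h) = phi_ r h.
Proof.
have UN : Upsilon (- h) = Upsilon h.
  by apply/matrixP => i l; rewrite !mxE !sqrrN !mulrNN.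
by rewrite /phi_ UN.
Qed.

(* The coefficient of [e^4 /\ e^(7 - i)] in [omega i] is 1, and the basis is
   indexed from 0 here. *)
Lemma phi_Upsilon h (i l : 'I_3) : sphere3 h ->
  phi_ r h (inord l) (inord 3) (inord (6 - i)) = Upsilon h i l.
Proof.
move=> hS; rewrite -(ev_phi r) -(ev_Upsilon r) !inordK //; last 2 first.
  by rewrite ltnS leq_subr.
  exact: leq_trans (ltn_ord l) _.
by case: i l => [[|[|[|i]]] // ?] [[|[|[|l]]] // ?].
Qed.

(** The products h_i h_j determine h up to sign: a nonzero h_k is known up to sign from its square,
    and the other coordinates follow on dividing by it. *)
Lemma eq_mul_rV h h' : (forall i j, h 0 i * h 0 j = h' 0 i * h' 0 j) ->
  h' = h \/ h' = - h.
Proof.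
move=> hh'; have [h0|] := eqVneq h 0.
  left; rewrite h0; apply/rowP => i; have := hh' i i.
  by rewrite h0 !mxE mul0r => /esym/eqP; rewrite mulf_eq0 orbb => /eqP.
move=> /rV0Pn[k hk]; have := hh' k k; rewrite -!expr2 => /eqP.
rewrite eqf_sqr => /orP[] /eqP hkE; [left | right]; apply/rowP => i.
  by apply: (mulIf hk); rewrite {1}hkE -hh'.
rewrite mxE; apply: (mulIf hk).
by rewrite {1}hkE mulrN -hh' mulNr.
Qed.

Lemma phi_inj h h' : sphere3 h -> sphere3 h' -> phi_ r h = phi_ r h' ->
  h' = h \/ h' = - h.
Proof.
move=> hS hS' E.
have U i l : Upsilon h i l = Upsilon h' i l by rewrite -!phi_Upsilon // E.
have S := sphere3E hS; have S' := sphere3E hS'.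
have := (U 0 0, U 0 1, U 0 2, (U 1 0, U 1 1, U 1 2), (U 2 0, U 2 1, U 2 2)).
rewrite !mxE /= => -[[[[? ?] ?] [[? ?] ?]] [[? ?] ?]].
(* The nine entries of [Upsilon] and the norm are linear in the ten products h_i h_j and determine
   them, so [lra] suffices. *)
suff H : [/\ h 0 0 * h 0 0 = h' 0 0 * h' 0 0, h 0 1 * h 0 1 = h' 0 1 * h' 0 1,
    h 0 2 * h 0 2 = h' 0 2 * h' 0 2 & h 0 3 * h 0 3 = h' 0 3 * h' 0 3] /\
   [/\ h 0 0 * h 0 1 = h' 0 0 * h' 0 1, h 0 0 * h 0 2 = h' 0 0 * h' 0 2,
    h 0 0 * h 0 3 = h' 0 0 * h' 0 3 & [/\ h 0 1 * h 0 2 = h' 0 1 * h' 0 2,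
    h 0 1 * h 0 3 = h' 0 1 * h' 0 3 & h 0 2 * h 0 3 = h' 0 2 * h' 0 3]].
  apply: eq_mul_rV.
  case: H => [[? ? ? ?] [? ? ? [? ? ?]]].
  move=> i j; have idx (k : 'I_4) : k \in [:: 0; 1; 2; 3].
    by case: k => [[|[|[|[|k]]]] ?].
  move: (idx i) (idx j); rewrite !inE.
  by do 2!(case/or4P=> /eqP->); rewrite // mulrC [RHS]mulrC.
by split; last split; try split; lra.
Qed.
End Parametrisation.

(** The shape of the energy along the great circle from h towards v, with a = h_2 and b = v_2. *)
Lemma is_derive_sqr_circle (R : realType) (x y a b : R) :
  is_derive (0 : R) 1 (fun t : R => x + y * (cos t * a + sin t * b) ^+ 2)
    (2 * y * (a * b)).
Proof.
have -> : (fun t : R => x + y * (cos t * a + sin t * b) ^+ 2) =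
    cst x + y *: ((a *: cos + b *: sin) ^+ 2).
  apply/funext => t; rewrite !fctE /= /GRing.scale /=.
  by rewrite (mulrC a) (mulrC b).
have dg := is_deriveD (is_deriveZ a (is_derive_cos 0))
                      (is_deriveZ b (is_derive_sin 0)).
have dx := is_derive_cst (x : R^o) (0 : R^o) (1 : R^o).
have dX := is_deriveX 2 dg.
apply: (is_derive_eq (is_deriveD dx (is_deriveZ y dX))).
rewrite !fctE /GRing.scale /= -[a *: cos 0]/(a * cos 0).
by rewrite -[b *: sin 0]/(b * sin 0) cos0 sin0; ring.
Qed.

(** * Harmonicity and criticality as one condition on h *)

Section CriticalPoints.
Variables (R : realType) (r : R).
Hypothesis hr : 0 < r.
Implicit Types h v : 'rV[R]_4.

Let c := (r ^+ 3 - 1) * (r ^+ 3 + 2).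

(** For r > 0 the factor r^3 + 2 is positive, and r^3 = 1 only at r = 1. *)
Lemma torsion_coef_eq0 : (c == 0) = (r == 1).
Proof.
have r3 : 0 < r ^+ 3 by rewrite exprn_gt0.
rewrite /c mulf_eq0 [r ^+ 3 + 2 == 0]gt_eqF ?addr_gt0 ?ltr0n // orbF.
by rewrite subr_eq0 pexpr_eq1 // ltW.
Qed.

(** The common condition through which the zeros of div T and the critical points of E are compared;
    including r = 1 treats both regimes at once. *)
Definition harmonic_locus h := [\/ r = 1, h 0 2 = 0 |
  [/\ h 0 0 = 0, h 0 1 = 0 & h 0 3 = 0]].

Lemma harmonic_locusP h : harmonic_locus h <->
  [/\ c * (h 0 2 * h 0 0) = 0, c * (h 0 2 * h 0 1) = 0 &
      c * (h 0 2 * h 0 3) = 0].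
Proof.
split=> [[r1|->|[-> -> ->]]|].
- have -> : c = 0 by apply/eqP; rewrite torsion_coef_eq0 r1.
  by rewrite !mul0r.
- by rewrite !mul0r !mulr0.
- by rewrite !mulr0.
move=> [E0 E1 E3]; have [r1|r1] := eqVneq r 1; first by constructor 1.
have c0 : c != 0 by rewrite torsion_coef_eq0.
have [h2|h2] := eqVneq (h 0 2) 0; first by constructor 2.
by constructor 3; split; apply: (mulfI h2); rewrite mulr0; apply: (mulfI c0);
  rewrite mulr0.
Qed.

Lemma harmonicP h : sphere3 h -> is_harmonic (phi_ r h) <-> harmonic_locus h.
Proof.
move=> hS; rewrite harmonic_locusP; split.
  move=> H; have := (H 0, H 1, H 2); rewrite !div_torsionE // => -[[] /=].
  have k : 4 / r != 0 by rewrite mulf_neq0 ?invr_eq0 ?pnatr_eq0 ?gt_eqF.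
  (* Components 0, 1, 2 of div T carry h2 h3, h2 h0, h2 h1, hence the order [E1], [E2], [E0]. *)
  by move=> E0 E1 E2; split; apply: (mulfI k); rewrite mulr0;
    [rewrite -[RHS]oppr0 -[in RHS]E1 | rewrite -[RHS]E2
      | rewrite -[RHS]oppr0 -[in RHS]E0];
    rewrite /c; ring.
case=> E0 E1 E3 j; rewrite div_torsionE //.
rewrite -[4 * _ * _]mulrA -/c -mulrA (mulrC r^-1) mulrA -(mulrA 4).
suff -> : c * [:: - (h 0 2 * h 0 3); - (h 0 2 * h 0 0); h 0 2 * h 0 1]`_j = 0.
  by rewrite mulr0 mul0r.
by case: j => [[|[|[|j]]] ?] /=;
  rewrite ?nth_nil ?mulrN ?E0 ?E1 ?E3 ?oppr0 ?mulr0.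
Qed.

(** The coefficient of h_2^2 in the energy. *)
Let K := 8 * (2^-1 * total_volume R / r) * c.

Lemma sphere3_circle h v t : sphere3 h -> sphere3 v ->
  \sum_i h 0 i * v 0 i = 0 ->
  sphere3 (cos t *: h + sin t *: v).
Proof.
rewrite /sphere3 /= => hS vS hv; rewrite sum4 !mxE.
transitivity (cos t ^+ 2 * (\sum_i h 0 i ^+ 2) +
  sin t ^+ 2 * (\sum_i v 0 i ^+ 2) +
  2 * cos t * sin t * (\sum_i h 0 i * v 0 i)); first by rewrite !sum4; ring.
by rewrite hS vS hv !mulr1 mulr0 addr0 cos2Dsin2.
Qed.

Lemma energy_circle_derive h v : sphere3 h -> sphere3 v ->
  \sum_i h 0 i * v 0 i = 0 ->
  is_derive (0 : R) 1 (fun t : R => energy (phi_ r (cos t *: h + sin t *: v)))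
    (2 * K * (h 0 2 * v 0 2)).
Proof.
move=> hS vS hv.
rewrite (_ : (fun t : R => energy _) = fun t : R =>
    2^-1 * total_volume R / r * (4 * r ^+ 6 - 14 * r ^+ 3 + 19) +
    K * (cos t * h 0 2 + sin t * v 0 2) ^+ 2).
  exact: is_derive_sqr_circle.
apply/funext => t; rewrite energyE //; last exact: sphere3_circle.
by rewrite !mxE /K /c; ring.
Qed.

Lemma K_eq0 : (K == 0) = (r == 1).
Proof.
have V0 : total_volume R != 0.
  by rewrite !mulf_neq0 ?invr_neq0 ?expf_neq0 ?pnatr_eq0 ?gt_eqF ?pi_gt0.
have k0 (V : R) : V != 0 -> 8 * (2^-1 * V / r) != 0.
  move=> V_neq0; have r_neq0 := lt0r_neq0 hr.
  by rewrite !mulf_neq0 ?invr_neq0 ?pnatr_eq0.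
by rewrite /K mulf_eq0 (negPf (k0 _ V0)) torsion_coef_eq0.
Qed.

(** The derivative towards v is 2 K h_2 v_2. If K and h_2 are nonzero, criticality forces v_2 = 0
    for every unit tangent vector v, which suitable v turn into h_k = 0 for k other than 2. *)
Lemma criticalP h : sphere3 h ->
  (forall v, sphere3 v -> \sum_i h 0 i * v 0 i = 0 ->
    is_derive (0 : R) 1
      (fun t : R => energy (phi_ r (cos t *: h + sin t *: v))) 0) <->
  harmonic_locus h.
Proof.
move=> hS; split=> [crit|hE v vS hv]; last first.
  have := energy_circle_derive hS vS hv.
  suff -> : 2 * K * (h 0 2 * v 0 2) = 0 by [].
  case: hE => [r1|h2|[h0 h1 h3]].
  - by have /eqP -> : K == 0 by [rewrite K_eq0 r1]; rewrite mulr0 mul0r.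
  - by rewrite h2 mul0r mulr0.
  (* At a pole, orthogonality of h and v reduces to h_2 v_2 = 0. *)
  - by move: hv; rewrite sum4 h0 h1 h3 !mul0r !add0r addr0 => ->; rewrite mulr0.
have [r1|r1] := eqVneq r 1; first by constructor 1.
have [h2|h2] := eqVneq (h 0 2) 0; first by constructor 2.
have crit0 v : sphere3 v -> \sum_i h 0 i * v 0 i = 0 -> v 0 2 = 0.
  move=> vS hv; have [_ d0] := crit v vS hv.
  have [_ dE] := energy_circle_derive hS vS hv.
  have K2 : 2 * K != 0 by apply: mulf_neq0; rewrite ?pnatr_eq0 // K_eq0.
  by apply: (mulfI h2); apply: (mulfI K2); rewrite -dE d0 !mulr0.
(* Criticality along the tangent vector at h in the plane of e_k and e_2. *)
have hk0 (k : 'I_4) : k != 2 -> h 0 k = 0.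
  move=> k2; pose N := h 0 2 ^+ 2 + h 0 k ^+ 2.
  have N0 : 0 < N by rewrite ltr_wpDr ?sqr_ge0 // exprn_even_gt0.
  pose v : 'rV[R]_4 := (Num.sqrt N)^-1 *:
    (h 0 2 *: delta_mx 0 k - h 0 k *: delta_mx 0 2).
  have sN : Num.sqrt N ^+ 2 = N by rewrite sqr_sqrtr ?ltW.
  have sN0 : Num.sqrt N != 0 by rewrite gt_eqF // sqrtr_gt0.
  have vE i :
      v 0 i = (Num.sqrt N)^-1 * (h 0 2 * (i == k)%:R - h 0 k * (i == 2)%:R).
    by rewrite !mxE.
  (* Only the coordinates k and 2 of [v] can be nonzero; this serves both the norm of [v] and its
     product with h. *)
  have sum_v (F : 'I_4 -> R -> R) : (forall i, F i 0 = 0) ->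
      \sum_i F i (v 0 i) =
      F k ((Num.sqrt N)^-1 * h 0 2) + F 2 (- ((Num.sqrt N)^-1 * h 0 k)).
    move=> F0; rewrite (bigD1 k) // (bigD1 2) 1?eq_sym //=.
    rewrite big1 => [|i /andP[ik i2]].
      rewrite addr0 !vE !eqxx (negPf k2) [2 == k]eq_sym (negPf k2).
      by rewrite !mulr1 !mulr0 subr0 sub0r mulrN.
    by rewrite vE (negPf ik) (negPf i2) !mulr0 subrr mulr0 F0.
  have := crit0 v; rewrite vE eqxx [2 == k]eq_sym (negPf k2) mulr0 mulr1 add0r.
  move=> /(_ _ _)/eqP; rewrite mulf_eq0 invr_eq0 (negPf sN0) oppr_eq0 => H.
  apply/eqP; apply: H.
    rewrite /sphere3 /= (sum_v (fun _ x => x ^+ 2)); last first.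
      by move=> _; rewrite expr0n.
    rewrite sqrrN !exprMn -mulrDr exprVn sN -/N mulVf //; exact: lt0r_neq0.
  rewrite (sum_v (fun i x => h 0 i * x)); last by move=> i; rewrite mulr0.
  by ring.
by constructor 3; split; apply: hk0.
Qed.
End CriticalPoints.

Theorem theorem3 (R : realType) (r : R) (hr : 0 < r) :
  [/\ (* B_r is a family of invariant G2-structures inducing g_r and a fixed
         orientation, parametrised by RP^3 *)
      forall phi, B_ r phi ->
        [/\ Ad_invariant phi, induced_metric phi = g_ r & 0 < vol_coef phi],
      forall h h' : 'rV[R]_4, sphere3 h -> sphere3 h' ->
        (phi_ r h = phi_ r h' <-> (h' = h \/ h' = - h)),
      (* harmonic G2-structures in B_r = critical points of E on B_r *)
      [set phi | B_ r phi /\ is_harmonic phi] = Crit r,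
      r != 1 ->
        [set phi | B_ r phi /\ is_harmonic phi] = equator r `|` poles r
    & r = 1 -> [set phi | B_ r phi /\ is_harmonic phi] = B_ r].
Proof.
split.
- move=> _ [h hS <-]; split; first exact: Ad_invariant_phi.
    exact: induced_metric_phi.
  by rewrite vol_coef_phi.
- move=> h h' hS hS'; split=> [|[->|->]]; [exact: phi_inj|by []|].
  by rewrite phi_opp.
- apply/seteqP; split=> [_ [[h hS <-] hH]|_ [h [hS hC] <-]].
    by exists h => //; split=> //; apply/criticalP => //; apply/harmonicP.
  split; first by exists h.
  by apply/harmonicP => //; apply/criticalP.
- move=> /negP r1.
  apply/seteqP; split=> [_ [[h hS <-]]|_ [[h [hS h2] <-]|[h hP <-]]].
  + move=> /harmonicP-/(_ hr hS)[/eqP//|h2|[h0 h1 h3]]; [left|right];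
      exists h => //.
    (* The other coordinates being zero, the unit norm leaves h_2 = 1 or h_2 = -1. *)
    have := sphere3E hS; rewrite h0 h1 h3 !expr0n /= !add0r addr0 => /eqP.
    rewrite -subr_eq0 subr_sqr_1 mulf_eq0 subr_eq0 addr_eq0.
    by case/orP=> /eqP h2; [left|right]; apply: eq_rV4;
      rewrite !mxE ?h0 ?h1 ?h2 ?h3 ?oppr0.
  + split; first by exists h.
    by apply/harmonicP => //; constructor 2.
  + have hS : sphere3 h.
      by rewrite /sphere3 /= sum4; case: hP => ->; rewrite !mxE /=; ring.
    split; first by exists h.
    apply/harmonicP => //; constructor 3.
    by case: hP => ->; rewrite !mxE /= ?oppr0.
- move=> r1; apply/seteqP; split=> [phi []//|_ [h hS <-]].
  split; first by exists h.
  by apply/harmonicP => //; constructor 1.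
Qed.
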